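(* Let $\rho,\sigma,\tau,\rho_1,\rho_2,\sigma_1,\sigma_2$ be density operators on a finite-dimensional Hilbert space (with $\tau$ possibly on another finite-dimensional space in (ii)). Then: (i) $J_{\alpha,\beta}(\rho,\sigma)\ge 0$ whenever $\alpha\in(0,1),\beta\in(-\infty,0)\cup(0,1)$, or $\alpha\in(1,\infty),\beta\in[1,\infty)$; moreover for $\alpha\in(1,\infty),\beta\in[1,\infty)$, $J_{\alpha,\beta}(\rho,\sigma)\le \frac{1}{(1-\alpha)\beta}\big(2^{1-\alpha\beta}-1\big)$. (ii) For $\alpha\in(0,1)\cup(1,\infty),\beta\in(-\infty,0)\cup(0,\infty)$: $J_{\alpha,\beta}(\rho\otimes\tau,\sigma\otimes\tau)=\big[1+(1-\alpha)\beta S_{\alpha,\beta}(\tau)\big]J_{\alpha,\beta}(\rho,\sigma)$; in particular, if $\tau$ is pure then $J_{\alpha,\beta}(\rho\otimes\tau,\sigma\otimes\tau)=J_{\alpha,\beta}(\rho,\sigma)$. (iii) For $\alpha\in(0,1)\cup(1,\infty),\beta\in(-\infty,0)\cup(0,\infty)$ and any unitary $U$: $J_{\alpha,\beta}(U\rho U^\dagger,U\sigma U^\dagger)=J_{\alpha,\beta}(\rho,\sigma)$. (iv) For $\alpha\in(0,1)\cup(1,\infty),\beta\in(-\infty,0)\cup(0,\infty)$: $J_{\alpha,\beta}(\rho,\sigma)=J_{\alpha,\beta}(\sigma,\rho)$. (v) For $\alpha\in(1,\infty),\beta\in[1,\infty)$: $|J_{\alpha,\beta}(\rho_1,\sigma)-J_{\alpha,\beta}(\rho_2,\sigma)|\le\frac{\alpha}{\alpha-1}\|\rho_1-\rho_2\|_1$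 and $|J_{\alpha,\beta}(\rho,\sigma_1)-J_{\alpha,\beta}(\rho,\sigma_2)|\le\frac{\alpha}{\alpha-1}\|\sigma_1-\sigma_2\|_1$.
   Context: For a density operator $\rho$, $\alpha\in(0,1)\cup(1,\infty)$, $\beta\in(-\infty,0)\cup(0,\infty)$, the quantum $(\alpha,\beta)$ entropy is $S_{\alpha,\beta}(\rho)=\frac{1}{(1-\alpha)\beta}\big[(\mathrm{Tr}\,\rho^{\alpha})^{\beta}-1\big]$. The quantum $(\alpha,\beta)$ Jensen–Shannon divergence is $J_{\alpha,\beta}(\rho,\sigma)=S_{\alpha,\beta}\big(\tfrac{\rho+\sigma}{2}\big)-\tfrac12 S_{\alpha,\beta}(\rho)-\tfrac12 S_{\alpha,\beta}(\sigma)$. The trace distance is normalized as $\|A\|_1=\tfrac12\mathrm{Tr}|A|$. *)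

(* Defs.v *)
From HB Require Import structures.
From mathcomp Require Import all_boot all_order all_algebra.
From mathcomp Require Import sesquilinear spectral.
From mathcomp Require Import complex mxtens.
From mathcomp Require Import reals exp.

Set Implicit Arguments.
Unset Strict Implicit.
Unset Printing Implicit Defensive.

Import Order.TTheory GRing.Theory Num.Theory.
Local Open Scope ring_scope.

Section QuantumDefs.
Variable R : realType.
Local Notation C := (R[i]).

Definition dagger {m n} (A : 'M[C]_(m, n)) : 'M[C]_(n, m) := (map_mx Num.conj A)^T.

Definition is_density {n} (rho : 'M[C]_n) : Prop :=
  [/\ dagger rho = rho,
      (forall v : 'rV[C]_n, 0 <= (v *m rho *m dagger v) 0 0)
    & \tr rho = 1].

Definition is_unitary_op {n} (U : 'M[C]_n) : Prop := U *m dagger U = 1%:M.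

(* functional calculus for a normal (in particular Hermitian) matrix
   A = P^-1 diag(d) P with P unitary (mathcomp's spectral decomposition):
   f(A) = P^-1 diag(f(d)) P, with f applied to the (real) eigenvalues. *)
Definition mxfun {n} (f : R -> R) (A : 'M[C]_n) : 'M[C]_n :=
  invmx (spectralmx A)
  *m diag_mx (map_mx (fun z : C => ((f (complex.Re z))%:C)%C) (spectral_diag A))
  *m spectralmx A.

Definition mxpowR {n} (A : 'M[C]_n) (a : R) : 'M[C]_n := mxfun (fun x => powR x a) A.
Definition mxabs {n} (A : 'M[C]_n) : 'M[C]_n := mxfun (fun x => `|x|) A.

Definition retr {n} (A : 'M[C]_n) : R := complex.Re (\tr A).

Definition Sab (a b : R) {n} (rho : 'M[C]_n) : R :=
  ((powR (retr (mxpowR rho a)) b) - 1) / ((1 - a) * b).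

Definition Jab (a b : R) {n} (rho sigma : 'M[C]_n) : R :=
  Sab a b ((2%:R)^-1 *: (rho + sigma)) - 2^-1 * Sab a b rho - 2^-1 * Sab a b sigma.

(* normalized trace norm  ||A||_1 = (1/2) Tr |A| *)
Definition trnorm {n} (A : 'M[C]_n) : R := 2^-1 * retr (mxabs A).

(* pure state: rho = |psi><psi| for a unit vector psi (here psi is the row
   vector v, |psi> = v^dagger, so rho = v^dagger v and <psi|psi> = v v^dagger = 1) *)
Definition is_pure {n} (rho : 'M[C]_n) : Prop :=
  exists v : 'rV[C]_n, (v *m dagger v) 0 0 = 1 /\ rho = dagger v *m v.

End QuantumDefs.

(* Main.v *)
Require Import Defs.
From HB Require Import structures.
From mathcomp Require Import all_boot all_order all_algebra.
From mathcomp Require Import sesquilinear spectral.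
From mathcomp Require Import complex mxtens.
From mathcomp Require Import reals exp.
From mathcomp Require Import ring lra.

Set Implicit Arguments.
Unset Strict Implicit.
Unset Printing Implicit Defensive.

Import Order.TTheory GRing.Theory Num.Theory.
Local Open Scope ring_scope.

(** If A has eigenvalues d_j and eigenbasis v_j, then in any orthonormal basis
    u_i one has <u_i|A|u_i> = sum_j |<u_i,v_j>|^2 d_j, with doubly stochastic
    weights. Hence Tr f(A) does not depend on the chosen diagonalization (which
    gives tensor products and unitary invariance), and
    sum_i f(<u_i|A|u_i>) <= Tr f(A) for convex f (Peierls). Applied in the
    eigenbasis of (rho + sigma)/2 this gives convexity of rho |-> Tr f(rho) and
    so J >= 0; applied in the eigenbasis of rho_1, both to x^alpha and to |x|,
    it gives Tr rho_1^alpha - Tr rho_2^alpha <= alpha ||rho_1 - rho_2||_1.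
    The upper bound on J follows from McCarthy's superadditivity
    Tr A^alpha + Tr B^alpha <= Tr (A + B)^alpha. *)

(** * Powers of real numbers *)

(** Young's inequality for the factors [u^p] and 1, with conjugate exponents [1/p] and [1/(1-p)]. *)
Lemma bernoulli_powR_lt1 (R : realType) (p u : R) :
  0 < p < 1 -> 0 <= u -> powR u p <= 1 + p * (u - 1).
Proof.
move=> /andP[p0 p1] u0.
have q0 : 0 < 1 - p by rewrite subr_gt0.
have := @conjugate_powR R (powR u p) 1 p^-1 (1 - p)^-1.
rewrite powR1 powR_ge0 ler01 !invr_gt0 !invrK p0 q0 -powRrM mulfV ?gt_eqF//.
rewrite powRr1 // => /(_ isT isT isT isT).
have -> : p + (1 - p) = 1 by ring.
by move=> /(_ erefl) H; lra.
Qed.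

(** The concave case with exponent [1/p] at the point [u^p], solved for [u^p]. *)
Lemma bernoulli_powR_ge1 (R : realType) (p u : R) :
  1 <= p -> 0 <= u -> 1 + p * (u - 1) <= powR u p.
Proof.
rewrite le_eqVlt => /predU1P[<-|p1] u0; first by rewrite powRr1 //; lra.
have p0 : 0 < p by lra.
have pV : 0 < p^-1 < 1 by rewrite invr_gt0 p0 invf_lt1.
have := @bernoulli_powR_lt1 R _ _ pV (powR_ge0 u p).
rewrite -powRrM mulfV ?gt_eqF // powRr1 // -(ler_pM2l p0) mulrDr mulrA.
by rewrite mulfV ?gt_eqF //; lra.
Qed.

(** Here [u^p = exp (p ln u)], with [exp t >= 1 + t] and [ln u <= u - 1]; the sign of [p] reverses
    the second bound. *)
Lemma bernoulli_powR_lt0 (R : realType) (p u : R) :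
  p < 0 -> 0 < u -> 1 + p * (u - 1) <= powR u p.
Proof.
move=> p0 u0; rewrite /powR gt_eqF //.
apply: le_trans (expR_ge1Dx _).
rewrite lerD2l ler_nM2l //.
have := @le_ln1Dx R (u - 1); have -> : 1 + (u - 1) = u by ring.
by apply; lra.
Qed.

(** Bernoulli at [u = x / y], multiplied by [y^p]. The next two lemmas follow the same pattern. *)
Lemma tangent_powR_lt1 (R : realType) (p x y : R) :
  0 < p < 1 -> 0 <= x -> 0 < y ->
  powR x p <= powR y p + p * powR y (p - 1) * (x - y).
Proof.
move=> p01 x0 y0; have y_neq0 : y != 0 by rewrite gt_eqF.
have /andP[p0 _] := p01.
have u0 : 0 <= x / y by rewrite divr_ge0 // ltW.
have -> : powR x p = powR y p * powR (x / y) p.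
  by rewrite -powRM // ?ltW // mulrCA mulfV // mulr1.
have -> : powR y p + p * powR y (p - 1) * (x - y)
        = powR y p * (1 + p * (x / y - 1)).
  by rewrite -(@mulr_powRB1 R y p (ltW y0) p0); field.
by rewrite ler_pM2l ?powR_gt0 // bernoulli_powR_lt1.
Qed.

Lemma tangent_powR_ge1 (R : realType) (p x y : R) :
  1 <= p -> 0 <= x -> 0 <= y ->
  powR y p + p * powR y (p - 1) * (x - y) <= powR x p.
Proof.
move=> p1 x0; have p0 : 0 < p by lra.
rewrite le_eqVlt => /predU1P[<-|y0].
  (* At [y = 0] the slope [p * 0^(p-1)] is 1 for [p = 1], because [0^0 = 1], and 0 for [p > 1]. *)
  rewrite subr0; move: p1; rewrite le_eqVlt => /predU1P[<-|p1].
    by rewrite subrr powRr0 powR0 ?oner_neq0 // !mul1r add0r powRr1.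
  rewrite !powR0 ?subr_eq0 ?gt_eqF // mulr0 mul0r addr0.
  exact: powR_ge0.
have y_neq0 : y != 0 by rewrite gt_eqF.
have u0 : 0 <= x / y by rewrite divr_ge0 // ltW.
have -> : powR x p = powR y p * powR (x / y) p.
  by rewrite -powRM // ?ltW // mulrCA mulfV // mulr1.
have -> : powR y p + p * powR y (p - 1) * (x - y)
        = powR y p * (1 + p * (x / y - 1)).
  by rewrite -(@mulr_powRB1 R y p (ltW y0) p0); field.
by rewrite ler_pM2l ?powR_gt0 // bernoulli_powR_ge1.
Qed.

Lemma tangent_powR_lt0 (R : realType) (p x y : R) :
  p < 0 -> 0 < x -> 0 < y ->
  powR y p + p * (powR y p / y) * (x - y) <= powR x p.
Proof.
move=> p0 x0 y0; have y_neq0 : y != 0 by rewrite gt_eqF.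
have u0 : 0 < x / y by rewrite divr_gt0.
have -> : powR x p = powR y p * powR (x / y) p.
  by rewrite -powRM // ?ltW // mulrCA mulfV // mulr1.
have -> : powR y p + p * (powR y p / y) * (x - y)
        = powR y p * (1 + p * (x / y - 1)) by field.
by rewrite ler_pM2l ?powR_gt0 // bernoulli_powR_lt0.
Qed.

(** Convexity on the half-line in the form that meets the rows of a doubly stochastic matrix;
    concave functions enter through their negatives. *)
Definition jensen_nneg (R : realType) (f : R -> R) : Prop :=
  forall n (p x : 'I_n -> R), (forall j, 0 <= p j) -> \sum_j p j = 1 ->
    (forall j, 0 <= x j) -> f (\sum_j p j * x j) <= \sum_j p j * f (x j).

(** Tangent inequalities at the barycentre [y] are summed. Missing mass only helps: with [s] the
    total weight, the surplus is [(a - 1) * y^a * (1 - s)]. Such deficient weights occur in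
    McCarthy's inequality. *)
Lemma jensen_powR_subproba (R : realType) (a : R) n (p x : 'I_n -> R) :
  1 <= a -> (forall j, 0 <= p j) -> \sum_j p j <= 1 ->
  (forall j, 0 <= x j) ->
  powR (\sum_j p j * x j) a <= \sum_j p j * powR (x j) a.
Proof.
move=> a1 p0 p1 x0; set y := \sum_j p j * x j.
have y0 : 0 <= y by apply: sumr_ge0 => j _; rewrite mulr_ge0.
have : \sum_j p j * (powR y a + a * powR y (a - 1) * (x j - y))
     <= \sum_j p j * powR (x j) a.
  by apply: ler_sum => j _; rewrite ler_wpM2l // tangent_powR_ge1.
apply: le_trans.
rewrite (eq_bigr (fun j => p j * (powR y a - a * (y * powR y (a - 1)))
   + p j * x j * (a * powR y (a - 1)))); last by move=> j _; ring.
rewrite big_split /= -!mulr_suml -/y mulr_powRB1 //; last by lra.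
have -> : y * (a * powR y (a - 1)) = a * powR y a.
  by rewrite mulrCA mulr_powRB1 //; lra.
rewrite -subr_ge0; set s := \sum_j p j in p1 *; set P := powR y a.
have -> : s * (P - a * P) + a * P - P = (a - 1) * P * (1 - s) by ring.
by rewrite !mulr_ge0 ?powR_ge0 ?subr_ge0.
Qed.

Lemma jensen_powR_ge1 (R : realType) (a : R) :
  1 <= a -> jensen_nneg (fun x => powR x a).
Proof.
by move=> a1 n p x p0 p1 x0; apply: jensen_powR_subproba; rewrite ?p1.
Qed.

Lemma jensen_powR_lt1 (R : realType) (a : R) :
  0 < a < 1 -> jensen_nneg (fun x => - powR x a).
Proof.
move=> a01 n p x p0 p1 x0; set y := \sum_j p j * x j.
have /andP[a0 _] := a01.
have y0 : 0 <= y by apply: sumr_ge0 => j _; rewrite mulr_ge0.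
rewrite (eq_bigr (fun j => - (p j * powR (x j) a))) => [|j _]; last first.
  by rewrite mulrN.
(* There is no tangent at a zero barycentre, but then every [p j * x j] vanishes, and with it every
   weighted power. *)
rewrite sumrN lerN2; move: y0; rewrite le_eqVlt => /predU1P[y0|y0].
  rewrite big1 ?powR_ge0 // => j _.
  have /eqP : \sum_j p j * x j = 0 by rewrite -/y -y0.
  rewrite psumr_eq0 => [/allP/(_ j)|i _]; last by rewrite mulr_ge0.
  rewrite mem_index_enum /= => /(_ isT).
  rewrite mulf_eq0 => /orP[/eqP->|/eqP->]; first by rewrite mul0r.
  by rewrite powR0 ?gt_eqF // mulr0.
have : \sum_j p j * powR (x j) a
   <= \sum_j p j * (powR y a + a * powR y (a - 1) * (x j - y)).
  by apply: ler_sum => j _; rewrite ler_wpM2l // tangent_powR_lt1.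
move/le_trans; apply.
rewrite (eq_bigr (fun j => p j * (powR y a - a * (y * powR y (a - 1)))
   + p j * x j * (a * powR y (a - 1)))); last by move=> j _; ring.
rewrite big_split /= -!mulr_suml -/y p1.
by rewrite le_eqVlt; apply/orP; left; apply/eqP; ring.
Qed.

Lemma jensen_mid (R : realType) (f : R -> R) (x y : R) :
  jensen_nneg f -> 0 <= x -> 0 <= y ->
  f (2^-1 * (x + y)) <= 2^-1 * (f x + f y).
Proof.
move=> fJ x0 y0.
have := fJ 2 (fun=> 2^-1) (fun i => if i == ord0 then x else y).
rewrite !big_ord_recl !big_ord0 /= !addr0 !mulrDr; apply.
- by move=> _; rewrite invr_ge0 ler0n.
- by field.
- by move=> j; case: ifP.
Qed.

(** The tangent inequalities at the midpoint are added and their linear terms cancel. [jensen_nneg]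
    is out of reach: [powR] sets [0^p = 0] for [p < 0], which breaks convexity at 0. *)
Lemma powR_mid_lt0 (R : realType) (p x y : R) : p < 0 -> 0 < x -> 0 < y ->
  powR (2^-1 * (x + y)) p <= 2^-1 * (powR x p + powR y p).
Proof.
move=> p0 x0 y0; set m := 2^-1 * (x + y).
have m0 : 0 < m by rewrite /m; lra.
have := tangent_powR_lt0 p0 x0 m0.
have := tangent_powR_lt0 p0 y0 m0.
have -> : x = m + m - y by rewrite /m; lra.
set k := p * _; lra.
Qed.

(** The tangent at [x] has slope between 0 and [a], whence the positive part of [x - y]. It is
    written as half of [|x - y| + (x - y)] because the linear terms later sum to a difference of
    traces, which is 0 for states. *)
Lemma powR_sub_le (R : realType) (a x y : R) :
  1 <= a -> 0 <= x <= 1 -> 0 <= y ->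
  powR x a - powR y a <= a * (2^-1 * (`|x - y| + (x - y))).
Proof.
move=> a1 /andP[x0 x1] y0.
have H := tangent_powR_ge1 a1 y0 x0.
have : powR x (a - 1) <= 1.
  move: a1; rewrite le_eqVlt => /predU1P[<-|a1]; first by rewrite subrr powRr0.
  have := @ge0_ler_powR R (a - 1) _ x 1.
  by rewrite powR1 !nnegrE; apply => //; lra.
have := powR_ge0 x (a - 1); set k := powR x (a - 1) in H * => k0 k1.
have [xy|xy] := ger0P (x - y).
  apply: (@le_trans _ _ (a * (k * (x - y)))); first by lra.
  rewrite ler_pM2l; last by lra.
  have : 0 <= (1 - k) * (x - y) by rewrite mulr_ge0 ?subr_ge0 // -subr_ge0.
  by lra.
have -> : - (x - y) + (x - y) = 0 by ring.
apply: (@le_trans _ _ (a * (k * (x - y)))); first by lra.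
rewrite ler_pM2l; last by lra.
have : 0 <= k * (y - x) by rewrite mulr_ge0 //; lra.
by lra.
Qed.

(** In [x^p = x * x^(p-1)] the second factor grows with the base. *)
Lemma powR_superadd (R : realType) (p x y : R) :
  1 <= p -> 0 <= x -> 0 <= y -> powR x p + powR y p <= powR (x + y) p.
Proof.
move=> p1 x0 y0; have p0 : 0 < p by lra.
rewrite -!(@mulr_powRB1 R _ p) ?addr_ge0 // mulrDl.
by apply: lerD; apply: ler_wpM2l => //; apply: ge0_ler_powR;
  rewrite ?subr_ge0 ?nnegrE ?lerDl ?lerDr ?addr_ge0.
Qed.

(** * Diagonalizations and overlaps *)

Lemma daggerE (R : realType) m n (A : 'M[R[i]]_(m, n)) i j :
  dagger A i j = Num.conj (A j i).
Proof. by rewrite !mxE. Qed.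

Lemma daggerK (R : realType) m n (A : 'M[R[i]]_(m, n)) : dagger (dagger A) = A.
Proof. by apply/matrixP=> i j; rewrite !mxE conjCK. Qed.

Lemma daggerM (R : realType) m n k (A : 'M[R[i]]_(m, n)) (B : 'M_(n, k)) :
  dagger (A *m B) = dagger B *m dagger A.
Proof. by rewrite /dagger map_mxM trmx_mul. Qed.

Lemma daggerD (R : realType) m n (A B : 'M[R[i]]_(m, n)) :
  dagger (A + B) = dagger A + dagger B.
Proof. by apply/matrixP=> i j; rewrite !mxE rmorphD. Qed.

Lemma daggerN (R : realType) m n (A : 'M[R[i]]_(m, n)) :
  dagger (- A) = - dagger A.
Proof. by apply/matrixP=> i j; rewrite !mxE rmorphN. Qed.

Lemma conjC_realc (R : realType) (x : R) : Num.conj (x%:C)%C = (x%:C)%C.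
Proof. by apply: conj_Creal; apply/complex_realP; exists x. Qed.

Lemma daggerZ (R : realType) m n (c : R) (A : 'M[R[i]]_(m, n)) :
  dagger ((c%:C)%C *: A) = (c%:C)%C *: dagger A.
Proof. by apply/matrixP=> i j; rewrite !mxE rmorphM /= conjC_realc. Qed.

Lemma dagger_tens (R : realType) m n p q (A : 'M[R[i]]_(m, n))
  (B : 'M[R[i]]_(p, q)) : dagger (A *t B) = dagger A *t dagger B.
Proof. by rewrite /dagger map_mxT trmx_tens. Qed.

Definition rdiag (R : realType) n (d : 'I_n -> R) : 'M[R[i]]_n :=
  diag_mx (\row_i ((d i)%:C)%C).

Lemma rdiagE (R : realType) n (d : 'I_n -> R) i j :
  rdiag d i j = ((d i)%:C)%C *+ (i == j).
Proof. by rewrite !mxE; case: eqP => // ->. Qed.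

Lemma eq_rdiag (R : realType) n (d e : 'I_n -> R) :
  d =1 e -> rdiag d = rdiag e.
Proof. by move=> de; apply/matrixP=> i j; rewrite !rdiagE de. Qed.

Lemma dagger_rdiag (R : realType) n (d : 'I_n -> R) :
  dagger (rdiag d) = rdiag d.
Proof.
apply/matrixP=> i j; rewrite daggerE !rdiagE eq_sym rmorphMn /= conjC_realc.
by case: eqP => // ->.
Qed.

Lemma mul_rdiag (R : realType) n (d e : 'I_n -> R) :
  rdiag d *m rdiag e = rdiag (fun i => d i * e i).
Proof.
rewrite /rdiag mulmx_diag; congr diag_mx.
by apply/rowP=> i; rewrite !mxE rmorphM.
Qed.

Lemma mulmx_rdiagE (R : realType) m n (A : 'M[R[i]]_(m, n)) (d : 'I_n -> R) i j :
  (A *m rdiag d) i j = A i j * ((d j)%:C)%C.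
Proof. by rewrite /rdiag mul_mx_diag !mxE. Qed.

Lemma rdiag_mulmxE (R : realType) m n (A : 'M[R[i]]_(m, n)) (d : 'I_m -> R) i j :
  (rdiag d *m A) i j = ((d i)%:C)%C * A i j.
Proof. by rewrite /rdiag mul_diag_mx !mxE. Qed.

Definition sqmod (R : realType) (z : R[i]) : R :=
  complex.Re z ^+ 2 + complex.Im z ^+ 2.

Lemma sqmod_ge0 (R : realType) (z : R[i]) : 0 <= sqmod z.
Proof. by rewrite addr_ge0 ?sqr_ge0. Qed.

Lemma sqmodE (R : realType) (z : R[i]) : ((sqmod z)%:C)%C = z * Num.conj z.
Proof. by rewrite add_Re2_Im2 normCK. Qed.

Lemma sqmod_real (R : realType) (x : R) : sqmod (x%:C)%C = x ^+ 2.
Proof. by rewrite /sqmod /= expr0n addr0. Qed.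

Lemma sqmod_conj (R : realType) (z : R[i]) : sqmod (Num.conj z) = sqmod z.
Proof. by apply: (@complexI R); rewrite !sqmodE conjCK mulrC. Qed.

Lemma conj_rdiagE (R : realType) m n (W : 'M[R[i]]_(m, n)) (d : 'I_n -> R) i :
  (W *m rdiag d *m dagger W) i i = ((\sum_j sqmod (W i j) * d j)%:C)%C.
Proof.
rewrite mxE rmorph_sum; apply: eq_bigr => j _ /=.
by rewrite mulmx_rdiagE !mxE rmorphM /= sqmodE mulrAC.
Qed.

(** The choice of eigenbasis stays open (the rows of [U] are the daggers of eigenvectors), so that
    tensor products and unitary conjugates can bring their own diagonalization in place of
    [spectralmx]. *)
Definition diagonalizes (R : realType) n (U : 'M[R[i]]_n) (d : 'I_n -> R)
  (A : 'M[R[i]]_n) : Prop :=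
  is_unitary_op U /\ A = dagger U *m rdiag d *m U.

Definition eigval (R : realType) n (A : 'M[R[i]]_n) (i : 'I_n) : R :=
  complex.Re (spectral_diag A 0 i).

Definition overlap (R : realType) n (U V : 'M[R[i]]_n) (i j : 'I_n) : R :=
  sqmod ((U *m dagger V) i j).

Definition diagent (R : realType) n (U A : 'M[R[i]]_n) (i : 'I_n) : R :=
  complex.Re ((U *m A *m dagger U) i i).

Lemma unitary_opC (R : realType) n (U : 'M[R[i]]_n) :
  is_unitary_op U -> dagger U *m U = 1%:M.
Proof. exact: mulmx1C. Qed.

Lemma spectralmx_unitary_op (R : realType) n (A : 'M[R[i]]_n) :
  is_unitary_op (spectralmx A).
Proof.
have /unitarymxP := spectral_unitarymx A.
by rewrite /is_unitary_op /dagger map_trmx.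
Qed.

Lemma invmx_spectralmx (R : realType) n (A : 'M[R[i]]_n) :
  invmx (spectralmx A) = dagger (spectralmx A).
Proof. by rewrite invmx_unitary ?spectral_unitarymx // /dagger map_trmx. Qed.

Lemma spectral_diagonalizes (R : realType) n (A : 'M[R[i]]_n) :
  dagger A = A -> diagonalizes (spectralmx A) (eigval A) A.
Proof.
move=> Ah; split; first exact: spectralmx_unitary_op.
have hA : A \is hermsymmx.
  by apply/is_hermitianmxP; rewrite expr0 scale1r -map_trmx -/(dagger A) Ah.
have /orthomx_spectralP {1}-> := hermitian_normalmx hA.
rewrite invmx_spectralmx; congr (_ *m _ *m _); congr diag_mx.
apply/rowP=> i; rewrite mxE RRe_real //.
by have /mxOverP := hermitian_spectral_diag_real hA; apply.
Qed.

Lemma retr_mxfun (R : realType) n (f : R -> R) (A : 'M[R[i]]_n) :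
  retr (mxfun f A) = \sum_i f (eigval A i).
Proof.
rewrite /retr /mxfun mxtrace_mulC mulmxA mulmxV ?spectral_unit // mul1mx.
rewrite mxtrace_diag (eq_bigr (fun i => ((f (eigval A i))%:C)%C)).
  by rewrite -rmorph_sum.
by move=> i _; rewrite mxE.
Qed.

(** The product [U *m dagger V] is unitary, so its rows have norm one. *)
Lemma sum_overlapr (R : realType) n (U V : 'M[R[i]]_n) i :
  is_unitary_op U -> is_unitary_op V -> \sum_j overlap U V i j = 1.
Proof.
move=> uU uV; apply: (@complexI R); rewrite rmorph_sum /=.
have : ((U *m dagger V) *m dagger (U *m dagger V)) i i = 1.
  rewrite daggerM daggerK mulmxA -(mulmxA U) unitary_opC // mulmx1.
  by rewrite uU mxE eqxx.
apply: etrans; rewrite [RHS]mxE.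
by apply: eq_bigr => j _; rewrite sqmodE (daggerE (U *m dagger V)).
Qed.

Lemma overlapC (R : realType) n (U V : 'M[R[i]]_n) i j :
  overlap U V i j = overlap V U j i.
Proof.
by rewrite /overlap -[V *m dagger U]daggerK daggerM daggerK daggerE sqmod_conj.
Qed.

Lemma sum_overlapl (R : realType) n (U V : 'M[R[i]]_n) j :
  is_unitary_op U -> is_unitary_op V -> \sum_i overlap U V i j = 1.
Proof.
move=> uU uV; rewrite -(sum_overlapr j uV uU).
by apply: eq_bigr => i _; rewrite overlapC.
Qed.

Lemma diagonal_entry (R : realType) n (U V A : 'M[R[i]]_n) d i :
  diagonalizes V d A ->
  (U *m A *m dagger U) i i = ((\sum_j overlap U V i j * d j)%:C)%C.
Proof.
case=> _ ->; rewrite -conj_rdiagE daggerM daggerK.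
by rewrite !mulmxA.
Qed.

Lemma diagentE (R : realType) n (U V A : 'M[R[i]]_n) d i :
  diagonalizes V d A -> diagent U A i = \sum_j overlap U V i j * d j.
Proof. by move=> /diagonal_entry H; rewrite /diagent H. Qed.

Lemma diagent_self (R : realType) n (U A : 'M[R[i]]_n) d i :
  diagonalizes U d A -> diagent U A i = d i.
Proof.
case=> uU ->; rewrite /diagent !mulmxA uU mul1mx -mulmxA uU mulmx1.
by rewrite rdiagE eqxx.
Qed.

Lemma diagentD (R : realType) n (U A B : 'M[R[i]]_n) i :
  diagent U (A + B) i = diagent U A i + diagent U B i.
Proof. by rewrite /diagent mulmxDr mulmxDl mxE raddfD. Qed.

Lemma diagentB (R : realType) n (U A B : 'M[R[i]]_n) i :
  diagent U (A - B) i = diagent U A i - diagent U B i.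
Proof.
rewrite /diagent mulmxBr mulmxBl; move: (U *m A *m _) (U *m B *m _) => X Y.
by rewrite !mxE raddfB.
Qed.

Lemma sum_diagent (R : realType) n (U A : 'M[R[i]]_n) :
  is_unitary_op U -> \sum_i diagent U A i = retr A.
Proof.
move=> uU; rewrite -raddf_sum /= -/(mxtrace _) /retr.
by rewrite mxtrace_mulC mulmxA unitary_opC // mul1mx.
Qed.

Lemma diagonalizes_herm (R : realType) n (U A : 'M[R[i]]_n) d :
  diagonalizes U d A -> dagger A = A.
Proof. by case=> _ ->; rewrite !daggerM daggerK dagger_rdiag mulmxA. Qed.

(* The overlap matrix W intertwines the two diagonal forms, so
   |W_ij|^2 (d_i - e_j) = 0; summing over the doubly stochastic |W_ij|^2
   identifies the two sums. *)
Lemma diagonalizes_sum (R : realType) n (U V A : 'M[R[i]]_n) d e (f : R -> R) :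
  diagonalizes U d A -> diagonalizes V e A ->
  \sum_i f (d i) = \sum_i f (e i).
Proof.
move=> [uU AU] [uV AV]; set W := U *m dagger V.
have WE : rdiag d *m W = W *m rdiag e.
  have : U *m A *m dagger V = U *m A *m dagger V by [].
  rewrite {1}AU AV !mulmxA uU mul1mx -!mulmxA uV mulmx1 => ->.
  by rewrite /W !mulmxA.
have H i j : overlap U V i j * f (d i) = overlap U V i j * f (e j).
  have /matrixP/(_ i j) := WE.
  rewrite mulmx_rdiagE rdiag_mulmxE /overlap -/W mulrC => /eqP.
  rewrite -subr_eq0 -mulrBr -rmorphB /= mulf_eq0 => /orP[/eqP->|/eqP].
    by rewrite (@sqmod_real R 0) expr0n !mul0r.
  by move/(@complexI R _ 0)/eqP; rewrite subr_eq0 => /eqP->.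
transitivity (\sum_i \sum_j overlap U V i j * f (d i)).
  by apply: eq_bigr => i _; rewrite -mulr_suml sum_overlapr // mul1r.
rewrite exchange_big /=; apply: eq_bigr => j _.
rewrite (eq_bigr (fun i => overlap U V i j * f (e j))) => [|i _]; last exact: H.
by rewrite -mulr_suml sum_overlapl // mul1r.
Qed.

Lemma retr_mxfun_diag (R : realType) n (U A : 'M[R[i]]_n) d (f : R -> R) :
  diagonalizes U d A -> retr (mxfun f A) = \sum_i f (d i).
Proof.
move=> UA; rewrite retr_mxfun; apply: (diagonalizes_sum f _ UA).
exact/spectral_diagonalizes/(diagonalizes_herm UA).
Qed.

Lemma diagonalizesZ (R : realType) n (U A : 'M[R[i]]_n) d (c : R) :
  diagonalizes U d A -> diagonalizes U (fun i => c * d i) ((c%:C)%C *: A).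
Proof.
case=> uU ->; split=> //; rewrite scalemxAl scalemxAr.
congr (_ *m _ *m _); apply/matrixP=> i j.
by rewrite mxE !rdiagE rmorphM /= mulrnAr.
Qed.

Lemma diagonalizesJ (R : realType) n (U V A : 'M[R[i]]_n) d :
  is_unitary_op V -> diagonalizes U d A ->
  diagonalizes (U *m dagger V) d (V *m A *m dagger V).
Proof.
move=> uV [uU ->]; split.
  rewrite /is_unitary_op daggerM daggerK mulmxA -(mulmxA U) unitary_opC //.
  by rewrite mulmx1.
by rewrite daggerM daggerK !mulmxA.
Qed.

Lemma mxtens_index_eq m n (i k : 'I_m) (j l : 'I_n) :
  (mxtens_index (i, j) == mxtens_index (k, l)) = (i == k) && (j == l).
Proof. exact: (can_eq (@mxtens_indexK m n)). Qed.

Lemma diagonalizes_tens (R : realType) n k (U A : 'M[R[i]]_n)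
    (V B : 'M[R[i]]_k) d e :
  diagonalizes U d A -> diagonalizes V e B ->
  diagonalizes (U *t V)
    (fun l => d (mxtens_unindex l).1 * e (mxtens_unindex l).2) (A *t B).
Proof.
move=> [uU ->] [uV ->]; split.
  rewrite /is_unitary_op dagger_tens tensmx_mul uU uV.
  apply/matrixP=> i j; case: (mxtens_indexP i) => i1 i2.
  case: (mxtens_indexP j) => j1 j2; rewrite tensmxE !mxE.
  rewrite mxtens_index_eq.
  by case: eqP; case: eqP; rewrite ?mulr0 ?mul0r ?mulr1.
rewrite dagger_tens -!tensmx_mul; congr (_ *m _ *m _).
apply/matrixP=> i j; case: (mxtens_indexP i) => i1 i2.
case: (mxtens_indexP j) => j1 j2; rewrite tensmxE !rdiagE mxtens_indexK /=.
rewrite mxtens_index_eq rmorphM /=.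
by case: eqP; case: eqP; rewrite ?mulr0 ?mul0r ?mulr1.
Qed.

(** * Trace inequalities *)

Definition psd (R : realType) n (A : 'M[R[i]]_n) : Prop :=
  dagger A = A /\ forall v : 'rV[R[i]]_n, 0 <= (v *m A *m dagger v) 0 0.

Lemma density_psd (R : realType) n (A : 'M[R[i]]_n) : is_density A -> psd A.
Proof. by case. Qed.

Lemma psdD (R : realType) n (A B : 'M[R[i]]_n) : psd A -> psd B -> psd (A + B).
Proof.
move=> [hA pA] [hB pB]; split; first by rewrite daggerD hA hB.
by move=> v; rewrite mulmxDr mulmxDl mxE addr_ge0.
Qed.

Lemma psdZ (R : realType) n (c : R) (A : 'M[R[i]]_n) :
  0 <= c -> psd A -> psd ((c%:C)%C *: A).
Proof.
move=> c0 [hA pA]; split; first by rewrite daggerZ hA.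
by move=> v; rewrite -scalemxAr -scalemxAl mxE mulr_ge0 // ler0c.
Qed.

Lemma row_conjmx (R : realType) m n (U : 'M[R[i]]_(m, n)) (A : 'M[R[i]]_n) i :
  (row i U *m A *m dagger (row i U)) 0 0 = (U *m A *m dagger U) i i.
Proof.
rewrite -row_mul !mxE; apply: eq_bigr => j _.
by rewrite !mxE; congr (_ * Num.conj _); rewrite !mxE.
Qed.

Lemma psd_diagent_ge0 (R : realType) n (U A : 'M[R[i]]_n) i :
  psd A -> 0 <= diagent U A i.
Proof.
move=> [_ /(_ (row i U))]; rewrite row_conjmx lecE /diagent.
by case/andP.
Qed.

Lemma psd_eigval_ge0 (R : realType) n (A : 'M[R[i]]_n) i :
  psd A -> 0 <= eigval A i.
Proof.
move=> pA; have [hA _] := pA.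
by rewrite -(diagent_self i (spectral_diagonalizes hA)) psd_diagent_ge0.
Qed.

Lemma sum_eigval (R : realType) n (A : 'M[R[i]]_n) :
  dagger A = A -> \sum_i eigval A i = retr A.
Proof.
move=> hA; rewrite -(sum_diagent A (spectralmx_unitary_op A)).
by apply: eq_bigr => i _; rewrite (diagent_self _ (spectral_diagonalizes hA)).
Qed.

(** Jensen on each row of overlaps, then unit column sums. Jensen is asked only at the eigenvalues
    [d], which admits powers on nonnegative spectra as well as [|x|] on spectra of either sign. *)
Lemma peierls (R : realType) n (f : R -> R) (U V A : 'M[R[i]]_n) d :
  (forall p : 'I_n -> R, (forall j, 0 <= p j) -> \sum_j p j = 1 ->
     f (\sum_j p j * d j) <= \sum_j p j * f (d j)) ->
  is_unitary_op U -> diagonalizes V d A ->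
  \sum_i f (diagent U A i) <= \sum_j f (d j).
Proof.
move=> fJ uU VA; have [uV _] := VA.
apply: (@le_trans _ _ (\sum_i \sum_j overlap U V i j * f (d j))).
  apply: ler_sum => i _; rewrite (diagentE _ _ VA); apply: fJ.
    by move=> j; apply: sqmod_ge0.
  exact: sum_overlapr.
rewrite exchange_big /=; apply: ler_sum => j _.
by rewrite -mulr_suml sum_overlapl // mul1r.
Qed.

Lemma peierls_psd (R : realType) n (f : R -> R) (U A : 'M[R[i]]_n) :
  jensen_nneg f -> is_unitary_op U -> psd A ->
  \sum_i f (diagent U A i) <= retr (mxfun f A).
Proof.
move=> fJ uU pA; have [hA _] := pA.
rewrite retr_mxfun; apply: peierls (spectral_diagonalizes hA) => // p p0 p1.
by apply: fJ => // j; apply: psd_eigval_ge0.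
Qed.

Lemma diagentZ (R : realType) n (U A : 'M[R[i]]_n) (c : R) i :
  diagent U ((c%:C)%C *: A) i = c * diagent U A i.
Proof.
rewrite /diagent -scalemxAr -scalemxAl mxE.
by case: (_ i i) => x y /=; rewrite mul0r subr0.
Qed.

(** In the eigenbasis of the midpoint, each eigenvalue is the mean of the diagonal entries of [A]
    and [B]; scalar convexity applies entrywise, and Peierls leads back to the two traces. *)
Lemma retr_mxfun_mid (R : realType) n (f : R -> R) (A B : 'M[R[i]]_n) :
  jensen_nneg f -> psd A -> psd B ->
  retr (mxfun f (((2^-1)%:C)%C *: (A + B)))
    <= 2^-1 * (retr (mxfun f A) + retr (mxfun f B)).
Proof.
move=> fJ pA pB; set M := _ *: _.
have pM : psd M by apply: psdZ; [rewrite invr_ge0 ler0n|apply: psdD].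
have [hM _] := pM; set U := spectralmx M.
have uU : is_unitary_op U := spectralmx_unitary_op M.
have := lerD (peierls_psd fJ uU pA) (peierls_psd fJ uU pB).
rewrite -(@ler_pM2l _ (2^-1)) ?invr_gt0 ?ltr0n //; apply: le_trans.
rewrite retr_mxfun -big_split mulr_sumr; apply: ler_sum => i _ /=.
rewrite -(diagent_self i (spectral_diagonalizes hM)) -/U diagentZ diagentD.
by apply: jensen_mid => //; apply: psd_diagent_ge0.
Qed.

(** The sum is [a_i * t] with [t = <u_i|C^-1|u_i>], where [0^-1 = 0] makes [C^-1] a pseudo-inverse.
    Testing [A <= C] on [g = C^-1 u_i] gives [a_i * t^2 <= <g|A|g> <= <g|C|g> = t]. *)
Lemma psd_sub_eigval_weight (R : realType) n (U V A C : 'M[R[i]]_n) a c i :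
  diagonalizes U a A -> (forall j, 0 <= a j) ->
  diagonalizes V c C -> psd (C - A) ->
  \sum_j a i * overlap U V i j / c j <= 1.
Proof.
move=> [uU AE] a0 [uV CE] [_ pCA].
set W := U *m dagger V; set t := \sum_j overlap U V i j / c j.
have -> : \sum_j a i * overlap U V i j / c j = a i * t.
  by rewrite mulr_sumr; apply: eq_bigr => j _; rewrite mulrA.
(* As a product, [G] is [U] times the pseudo-inverse of [C]; its row [i] is the test vector. *)
set G := W *m rdiag (fun j => (c j)^-1) *m V.
have gC : (G *m C *m dagger G) i i = (t%:C)%C.
  have -> : G *m C *m dagger G = W *m rdiag (fun j => (c j)^-1) *m dagger W.
    rewrite /G CE !daggerM dagger_rdiag !mulmxA.
    rewrite -(mulmxA _ V (dagger V)) uV mulmx1 -(mulmxA _ V (dagger V)) uV.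
    rewrite mulmx1 -!(mulmxA W) !mul_rdiag; do 2!congr (_ *m _); congr (_ *m _).
    apply: eq_rdiag => j; have [->|cj] := eqVneq (c j) 0.
      by rewrite invr0 !mulr0.
    by rewrite mulVf // mul1r.
  by rewrite conj_rdiagE.
have gA : ((a i * t ^+ 2)%:C <= (G *m A *m dagger G) i i)%C.
  set X := G *m dagger U.
  have -> : G *m A *m dagger G = X *m rdiag a *m dagger X.
    by rewrite AE /X daggerM daggerK !mulmxA.
  have XE : X i i = (t%:C)%C.
    rewrite /X /G -mulmxA.
    have -> : V *m dagger U = dagger W by rewrite /W daggerM daggerK.
    by rewrite conj_rdiagE.
  (* Only the term of index [i] is kept; the others are nonnegative. *)
  rewrite conj_rdiagE lecR (bigD1 i) //= XE sqmod_real mulrC lerDl.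
  by apply: sumr_ge0 => j _; rewrite mulr_ge0 ?sqmod_ge0.
have := pCA (row i G); rewrite row_conjmx mulmxBr mulmxBl.
have -> (X Y : 'M[R[i]]_n) : (X - Y) i i = X i i - Y i i by rewrite !mxE.
rewrite subr_ge0 gC => /(le_trans gA); rewrite lecR => H.
have [t0|t0] := ltrP 0 t.
  by rewrite -(ler_pM2r t0) mul1r -mulrA -expr2.
by apply: le_trans (ler01); rewrite mulr_ge0_le0.
Qed.

(* McCarthy's inequality: in eigenbases u_i of A and v_j of C,
   the numbers a_i |<u_i, v_j>|^2 / c_j are sub-probability weights in j
   with barycentre a_i, and Jensen's inequality applies. *)
Lemma sum_powR_psd_sub (R : realType) n (V A C : 'M[R[i]]_n) c (al : R) :
  1 < al -> psd A -> diagonalizes V c C -> (forall j, 0 <= c j) -> psd (C - A) ->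
  retr (mxpowR A al) <= \sum_j diagent V A j * powR (c j) (al - 1).
Proof.
move=> al1 pA VC c0 pCA; have [hA _] := pA.
have UA := spectral_diagonalizes hA; set U := spectralmx A in UA.
have [uU _] := UA; have [uV _] := VC.
set a := eigval A in UA *; have a0 i : 0 <= a i by apply: psd_eigval_ge0.
pose w i j := a i * overlap U V i j.
have w0 i j : 0 <= w i j by rewrite mulr_ge0 ?sqmod_ge0.
have wE j : diagent V A j = \sum_i w i j.
  rewrite (diagentE _ _ UA); apply: eq_bigr => i _.
  by rewrite /w mulrC overlapC.
(* If [c j = 0], positivity of [C - A] forces the [j]-th diagonal entry of [A], a sum of nonnegative
   weights, to be 0; dividing by [c j] then loses nothing. *)
have wc0 i j : c j = 0 -> w i j = 0.
  move=> cj; have : diagent V (C - A) j >= 0 by apply: psd_diagent_ge0.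
  rewrite diagentB (diagent_self _ VC) cj sub0r oppr_ge0 wE => s0.
  have /eqP : \sum_i w i j = 0 by apply/eqP; rewrite eq_le s0 sumr_ge0.
  rewrite psumr_eq0 // => /allP/(_ i); rewrite mem_index_enum => /(_ isT).
  by move/eqP.
have aE i : a i = \sum_j w i j / c j * c j.
  rewrite -[LHS]mulr1 -(sum_overlapr i uU uV) mulr_sumr.
  apply: eq_bigr => j _; have [cj|cj] := eqVneq (c j) 0.
    by rewrite -/(w i j) wc0 // !mul0r.
  by rewrite divfK.
have al0 : 0 < al by lra.
rewrite /mxpowR retr_mxfun -/a.
apply: (@le_trans _ _ (\sum_i \sum_j w i j / c j * powR (c j) al)).
  apply: ler_sum => i _; rewrite {1}aE; apply: jensen_powR_subproba => //.
  - by lra.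
  - by move=> j; rewrite divr_ge0.
  - exact: (psd_sub_eigval_weight i UA a0 VC pCA).
rewrite exchange_big /=; apply: ler_sum => j _.
rewrite wE mulr_suml; apply: ler_sum => i _.
have [cj|cj] := eqVneq (c j) 0; first by rewrite wc0 // !mul0r.
by rewrite -(mulr_powRB1 (c0 j) al0) mulrA divfK.
Qed.

(** Both traces are bounded in the eigenbasis of [A + B]; there the diagonal entries of [A] and [B]
    add up to the eigenvalue [c_j], and [c_j * c_j^(al-1) = c_j^al]. *)
Lemma retr_mxpowR_superadd (R : realType) n (A B : 'M[R[i]]_n) (al : R) :
  1 < al -> psd A -> psd B ->
  retr (mxpowR A al) + retr (mxpowR B al) <= retr (mxpowR (A + B) al).
Proof.
move=> al1 pA pB; have pC := psdD pA pB; have [hC _] := pC.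
have VC := spectral_diagonalizes hC.
have c0 j : 0 <= eigval (A + B) j by apply: psd_eigval_ge0.
have pCA : psd (A + B - A) by rewrite addrAC subrr add0r.
have pCB : psd (A + B - B) by rewrite addrK.
apply: le_trans (lerD (sum_powR_psd_sub al1 pA VC c0 pCA)
                      (sum_powR_psd_sub al1 pB VC c0 pCB)) _.
rewrite -big_split /mxpowR retr_mxfun; apply: ler_sum => j _ /=.
rewrite -mulrDl -diagentD (diagent_self _ VC) mulr_powRB1 //; lra.
Qed.

(** * Entropies and divergences *)

Lemma complex_half (R : realType) : (2%:R)^-1 = ((2^-1)%:C)%C :> R[i].
Proof. by rewrite fmorphV rmorph_nat. Qed.

Lemma retr_mxpowR (R : realType) n (A : 'M[R[i]]_n) (a : R) :
  retr (mxpowR A a) = \sum_i powR (eigval A i) a.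
Proof. exact: retr_mxfun. Qed.

Lemma retr_mxpowR_diag (R : realType) n (U A : 'M[R[i]]_n) d (a : R) :
  diagonalizes U d A -> retr (mxpowR A a) = \sum_i powR (d i) a.
Proof. exact: retr_mxfun_diag. Qed.

Lemma retr_mxabs (R : realType) n (A : 'M[R[i]]_n) :
  retr (mxabs A) = \sum_i `|eigval A i|.
Proof. exact: retr_mxfun. Qed.

Lemma retr_mxabs_diag (R : realType) n (U A : 'M[R[i]]_n) d :
  diagonalizes U d A -> retr (mxabs A) = \sum_i `|d i|.
Proof. exact: retr_mxfun_diag. Qed.

Lemma mxpowRE (R : realType) n (A : 'M[R[i]]_n) (a : R) :
  mxpowR A a = mxfun (fun x => powR x a) A.
Proof. by []. Qed.

Lemma retrB (R : realType) n (A B : 'M[R[i]]_n) : retr (A - B) = retr A - retr B.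
Proof. by rewrite /retr !raddfB. Qed.

Lemma retr_density (R : realType) n (rho : 'M[R[i]]_n) :
  is_density rho -> retr rho = 1.
Proof. by case=> _ _; rewrite /retr => ->. Qed.

Lemma retr_mxfunN (R : realType) n (f : R -> R) (A : 'M[R[i]]_n) :
  retr (mxfun (fun x => - f x) A) = - retr (mxfun f A).
Proof.
by apply: etrans (retr_mxfun _ _) _; rewrite sumrN; congr (- _); rewrite retr_mxfun.
Qed.

(* Unification otherwise unfolds these down to the spectral theorem. *)
#[local] Opaque retr mxfun mxpowR mxabs.

Lemma density_mid (R : realType) n (rho sigma : 'M[R[i]]_n) :
  is_density rho -> is_density sigma ->
  is_density ((2%:R)^-1 *: (rho + sigma)).
Proof.
move=> dr ds; have [_ _ tr] := dr; have [_ _ ts] := ds.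
have [h p] : psd ((2%:R)^-1 *: (rho + sigma)).
  rewrite complex_half; apply: psdZ; first by rewrite invr_ge0 ler0n.
  by apply: psdD; apply: density_psd.
by split=> //; rewrite mxtraceZ mxtraceD tr ts mulVf // pnatr_eq0.
Qed.

Lemma density_sum_eigval (R : realType) n (rho : 'M[R[i]]_n) :
  is_density rho -> \sum_i eigval rho i = 1.
Proof. by move=> dr; rewrite -(retr_density dr) sum_eigval //; case: dr. Qed.

Lemma density_eigval_le1 (R : realType) n (rho : 'M[R[i]]_n) i :
  is_density rho -> 0 <= eigval rho i <= 1.
Proof.
move=> dr; have e0 j : 0 <= eigval rho j by apply/psd_eigval_ge0/density_psd.
rewrite e0 -(density_sum_eigval dr) (bigD1 i) //= lerDl.
by apply: sumr_ge0 => j _.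
Qed.

Lemma retr_mxpowR_ge0 (R : realType) n (A : 'M[R[i]]_n) (a : R) :
  0 <= retr (mxpowR A a).
Proof. by rewrite retr_mxpowR sumr_ge0 // => i _; apply: powR_ge0. Qed.

(** If every power vanished, so would every eigenvalue, against trace one. Strictness matters for a
    negative outer exponent [b]. *)
Lemma retr_mxpowR_gt0 (R : realType) n (rho : 'M[R[i]]_n) (a : R) :
  0 < a -> is_density rho -> 0 < retr (mxpowR rho a).
Proof.
move=> a0 dr; rewrite lt_neqAle retr_mxpowR_ge0 andbT eq_sym.
rewrite retr_mxpowR psumr_eq0 => [|i _]; last exact: powR_ge0.
apply/negP=> /allP H; have := density_sum_eigval dr.
rewrite big1 => [/eqP|i _]; first by rewrite eq_sym oner_eq0.
by have /(_ (mem_index_enum _))/eqP/powR_eq0_eq0 := H i.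
Qed.

Lemma retr_mxpowR_le1 (R : realType) n (rho : 'M[R[i]]_n) (a : R) :
  1 <= a -> is_density rho -> retr (mxpowR rho a) <= 1.
Proof.
move=> a1 dr; rewrite -(density_sum_eigval dr) retr_mxpowR.
apply: ler_sum => i _; have /andP[] := density_eigval_le1 i dr.
rewrite le_eqVlt => /predU1P[<- _|e0 e1].
  by rewrite powR0 //; lra.
by apply: ge1r_powR => //; rewrite e0 e1.
Qed.

(** The constants cancel because [1 - 1/2 - 1/2 = 0]; what remains is a Jensen-type gap for [u^b] at
    three traces. *)
Lemma JabE (R : realType) n (rho sigma : 'M[R[i]]_n) (a b : R) :
  Jab a b rho sigma =
  (powR (retr (mxpowR ((2%:R)^-1 *: (rho + sigma)) a)) b
   - 2^-1 * (powR (retr (mxpowR rho a)) b + powR (retr (mxpowR sigma a)) b))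
  / ((1 - a) * b).
Proof.
have E (X Y Z k : R) : (X - 1) * k - 2^-1 * ((Y - 1) * k) - 2^-1 * ((Z - 1) * k)
    = (X - 2^-1 * (Y + Z)) * k by field.
exact: E.
Qed.

(** * Nonnegativity and upper bound of the divergence *)

Lemma le_powR_lt0 (R : realType) (p x y : R) :
  p < 0 -> 0 < x -> x <= y -> powR y p <= powR x p.
Proof.
move=> p0 x0 xy; have y0 : 0 < y by apply: lt_le_trans xy.
have E z : powR z p = (powR z (- p))^-1 by rewrite -powRN opprK.
rewrite !E lef_pV2 ?posrE ?powR_gt0 //.
by apply: ge0_ler_powR; rewrite ?nnegrE ?oppr_ge0 // ltW.
Qed.

Lemma retr_mxpowR_mid_lt1 (R : realType) n (A B : 'M[R[i]]_n) (a : R) :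
  0 < a < 1 -> psd A -> psd B ->
  2^-1 * (retr (mxpowR A a) + retr (mxpowR B a))
    <= retr (mxpowR ((2%:R)^-1 *: (A + B)) a).
Proof.
move=> a01 pA pB; rewrite complex_half !mxpowRE.
have F (u v w u' v' w' : R) : u = - u' -> v = - v' -> w = - w' ->
  u <= 2^-1 * (v + w) -> 2^-1 * (v' + w') <= u' by lra.
exact: F (retr_mxfunN _ _) (retr_mxfunN _ _) (retr_mxfunN _ _)
  (retr_mxfun_mid (jensen_powR_lt1 a01) pA pB).
Qed.

Lemma retr_mxpowR_mid_ge1 (R : realType) n (A B : 'M[R[i]]_n) (a : R) :
  1 <= a -> psd A -> psd B ->
  retr (mxpowR ((2%:R)^-1 *: (A + B)) a)
    <= 2^-1 * (retr (mxpowR A a) + retr (mxpowR B a)).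
Proof.
move=> a1 pA pB; rewrite complex_half !mxpowRE.
exact: (retr_mxfun_mid (jensen_powR_ge1 a1) pA pB).
Qed.

(** For [a < 1], [m] lies above the mean of [x] and [y]: if [b < 0], [u^b] is decreasing and convex
    and the denominator negative; if [0 < b < 1], [u^b] is increasing and concave and the
    denominator positive. For [a > 1], [m] lies below the mean, [u^b] is increasing and convex, and
    the denominator is negative. *)
Lemma powR_jensen_gap_ge0 (R : realType) (a b x y m : R) :
  ((0 < a < 1) /\ (b < 0 \/ 0 < b < 1)) \/ (1 < a /\ 1 <= b) ->
  0 < x -> 0 < y -> 0 <= m ->
  (0 < a < 1 -> 2^-1 * (x + y) <= m) -> (1 <= a -> m <= 2^-1 * (x + y)) ->
  0 <= (powR m b - 2^-1 * (powR x b + powR y b)) / ((1 - a) * b).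
Proof.
move=> hab xp yp m0 H1 H2; have x0 := ltW xp; have y0 := ltW yp.
have h0 : 0 <= 2^-1 * (x + y) by rewrite mulr_ge0 ?addr_ge0 ?invr_ge0.
case: hab => [[a01 [b0|b01]]|[a1 b1]].
- have /andP[a0 a1] := a01.
  have D0 : (1 - a) * b < 0 by rewrite pmulr_rlt0 // subr_gt0.
  apply: mulr_le0; last by rewrite invr_le0 ltW.
  rewrite subr_le0.
  have hp : 0 < 2^-1 * (x + y) by rewrite mulr_gt0 ?invr_gt0 // addr_gt0 ?xp ?yp.
  apply: le_trans (le_powR_lt0 b0 hp (H1 a01)) _.
  by apply: powR_mid_lt0; rewrite ?xp ?yp.
- have /andP[a0 a1] := a01; have /andP[b0 b1] := b01.
  have D0 : 0 < (1 - a) * b by rewrite mulr_gt0 // subr_gt0.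
  apply: mulr_ge0; last by rewrite invr_ge0 ltW.
  rewrite subr_ge0.
  apply: (@le_trans _ _ (powR (2^-1 * (x + y)) b)).
    by have := jensen_mid (jensen_powR_lt1 b01) x0 y0; lra.
  by apply: ge0_ler_powR; rewrite ?nnegrE ?H1 // ltW.
- have D0 : (1 - a) * b < 0 by rewrite nmulr_rlt0 ?subr_lt0 //; lra.
  apply: mulr_le0; last by rewrite invr_le0 ltW.
  rewrite subr_le0.
  apply: (@le_trans _ _ (powR (2^-1 * (x + y)) b)).
    by apply: ge0_ler_powR; rewrite ?nnegrE ?H2 ?(ltW a1) //; lra.
  exact: (jensen_mid (jensen_powR_ge1 b1)).
Qed.

Lemma Jab_ge0 (R : realType) (a b : R) :
  ((0 < a < 1) /\ (b < 0 \/ 0 < b < 1)) \/ (1 < a /\ 1 <= b) ->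
  forall (n : nat) (rho sigma : 'M[R[i]]_n),
    is_density rho -> is_density sigma -> 0 <= Jab a b rho sigma.
Proof.
move=> hab n rho sigma dr ds; rewrite JabE.
have pr := density_psd dr; have ps := density_psd ds.
have a0 : 0 < a by case: hab => [[/andP[]]|[]]; lra.
apply: powR_jensen_gap_ge0 => //.
- exact: retr_mxpowR_gt0.
- exact: retr_mxpowR_gt0.
- exact: retr_mxpowR_ge0.
- by move=> a1; apply: retr_mxpowR_mid_lt1.
- by move=> a1; apply: retr_mxpowR_mid_ge1.
Qed.

Lemma retr_mxpowRZ (R : realType) n (A : 'M[R[i]]_n) (a c : R) :
  psd A -> 0 <= c ->
  retr (mxpowR ((c%:C)%C *: A) a) = powR c a * retr (mxpowR A a).
Proof.
move=> pA c0; have [hA _] := pA; have UA := spectral_diagonalizes hA.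
apply: etrans (retr_mxpowR_diag _ (diagonalizesZ c UA)) _.
rewrite retr_mxpowR mulr_sumr.
by apply: eq_bigr => i _; rewrite powRM // psd_eigval_ge0.
Qed.

(** Put [k = 2^(-ab)], [X = x^b], [Y = y^b]. Superadditivity gives [m^b = k z^b >= k (X + Y)], so
    the gap is at least [(k - 1/2)(X + Y)]. As [k <= 1/2] and [X + Y <= 2], this is at least
    [2k - 1], and [2k = 2^(1-ab)]. *)
Lemma powR_superadd_gap_le (R : realType) (a b x y z m : R) :
  1 < a -> 1 <= b -> 0 <= x -> 0 <= y -> x <= 1 -> y <= 1 -> x + y <= z ->
  m = powR (2^-1) a * z ->
  powR 2 (1 - a * b) - 1
    <= powR m b - 2^-1 * (powR x b + powR y b).
Proof.
move=> a1 b1 x0 y0 x1 y1 xyz ->; have b0 : 0 < b by lra.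
have z0 : 0 <= z by lra.
rewrite powRM ?powR_ge0 // -powRrM.
have k2 : powR 2 (1 - a * b) = 2 * powR (2^-1) (a * b).
  rewrite powRD; last by rewrite pnatr_eq0 implybT.
  by rewrite powRr1 // -powR_inv1 // -powRrM mulN1r.
have ab1 : 1 <= a * b
  by apply: le_trans b1 _; apply: ler_peMl; exact: ltW.
have kh : powR (2^-1) (a * b) <= 2^-1 :> R.
  by apply: ge1r_powR => //; apply/andP; split; lra.
rewrite k2; have := powR_ge0 (2^-1 : R) (a * b).
move: (powR (2^-1 : R) (a * b)) kh => k kh k0.
have le1 u : 0 <= u -> u <= 1 -> powR u b <= 1.
  move=> u0 u1; have := @ge0_ler_powR R b (ltW b0) u 1.
  by rewrite powR1 !nnegrE; apply.
have := le1 _ x0 x1; have := le1 _ y0 y1.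
have zb : powR x b + powR y b <= powR z b.
  apply: le_trans (powR_superadd b1 x0 y0) _.
  by apply: ge0_ler_powR; rewrite ?nnegrE ?addr_ge0 // ltW.
have := ler_wpM2l k0 zb.
move: (powR x b) (powR y b) (powR z b) => X Y Z H Y1 X1.
have : 0 <= (2^-1 - k) * (2 - (X + Y)) by rewrite mulr_ge0 //; lra.
by lra.
Qed.

Lemma Jab_le (R : realType) (a b : R) : 1 < a -> 1 <= b ->
  forall (n : nat) (rho sigma : 'M[R[i]]_n),
    is_density rho -> is_density sigma ->
    Jab a b rho sigma <= (powR 2 (1 - a * b) - 1) / ((1 - a) * b).
Proof.
move=> a1 b1 n rho sigma dr ds; rewrite JabE.
have pr := density_psd dr; have ps := density_psd ds.
have D0 : (1 - a) * b < 0 by rewrite nmulr_rlt0 ?subr_lt0 //; lra.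
(* The denominator is negative, so the numerator has to be bounded from below. *)
rewrite ler_nM2r ?invr_lt0 // complex_half.
have h0 : 0 <= 2^-1 :> R by rewrite invr_ge0.
apply: powR_superadd_gap_le (retr_mxpowRZ a (psdD pr ps) h0) => //.
- exact: retr_mxpowR_ge0.
- exact: retr_mxpowR_ge0.
- exact: retr_mxpowR_le1 (ltW a1) dr.
- exact: retr_mxpowR_le1 (ltW a1) ds.
- exact: retr_mxpowR_superadd a1 pr ps.
Qed.

(** * Tensor products, pure states and unitary conjugation *)

Lemma retr_mxpowR_tens (R : realType) n k (rho : 'M[R[i]]_n)
    (tau : 'M[R[i]]_k) (a : R) : psd rho -> psd tau ->
  retr (mxpowR (rho *t tau) a) = retr (mxpowR rho a) * retr (mxpowR tau a).
Proof.
move=> pr pt; have [hr _] := pr; have [ht _] := pt.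
have D := diagonalizes_tens (spectral_diagonalizes hr) (spectral_diagonalizes ht).
rewrite (retr_mxpowR_diag _ D) !retr_mxpowR mulr_sum.
by apply: eq_bigr => l _; rewrite powRM // psd_eigval_ge0.
Qed.

Lemma tensmxDl (R : pzRingType) m n p q (A B : 'M[R]_(m, n)) (C : 'M[R]_(p, q)) :
  (A + B) *t C = A *t C + B *t C.
Proof. by apply/matrixP=> i j; rewrite !mxE mulrDl. Qed.

Lemma tensmxZl (R : pzRingType) m n p q (c : R) (A : 'M[R]_(m, n))
  (C : 'M[R]_(p, q)) : (c *: A) *t C = c *: (A *t C).
Proof. by apply/matrixP=> i j; rewrite !mxE mulrA. Qed.

(** Each of the three traces picks up the factor [Tr tau^a], whose [b]-th power comes out of the
    whole gap. *)
Lemma Jab_tens (R : realType) n k (rho sigma : 'M[R[i]]_n)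
    (tau : 'M[R[i]]_k) (a b : R) :
  is_density rho -> is_density sigma -> is_density tau ->
  Jab a b (rho *t tau) (sigma *t tau)
    = powR (retr (mxpowR tau a)) b * Jab a b rho sigma.
Proof.
move=> dr ds dt; rewrite !JabE -tensmxDl -tensmxZl.
have dm := density_psd (density_mid dr ds).
have pr := density_psd dr; have ps := density_psd ds; have pt := density_psd dt.
have F (M X Y m x y t d : R) : M = m * t -> X = x * t -> Y = y * t ->
    0 <= m -> 0 <= x -> 0 <= y -> 0 <= t ->
    (powR M b - 2^-1 * (powR X b + powR Y b)) * d
    = powR t b * ((powR m b - 2^-1 * (powR x b + powR y b)) * d).
  by move=> -> -> -> m0 x0 y0 t0; rewrite !powRM //; ring.
apply: F (retr_mxpowR_tens a dm pt) (retr_mxpowR_tens a pr pt)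
  (retr_mxpowR_tens a ps pt) _ _ _ _; exact: retr_mxpowR_ge0.
Qed.

(** A pure state is a projection: its eigenvalues are 0 or 1, hence fixed by [x^a], and they sum to
    the trace. *)
Lemma retr_mxpowR_pure (R : realType) n (tau : 'M[R[i]]_n) (a : R) :
  0 < a -> is_density tau -> is_pure tau -> retr (mxpowR tau a) = 1.
Proof.
move=> a0 dt [v [v1 tE]]; have [ht _ _] := dt.
have [uU UE] := spectral_diagonalizes ht.
set U := spectralmx tau in uU UE.
have tt : tau *m tau = tau.
  rewrite tE mulmxA -(mulmxA (dagger v)).
  suff -> : v *m dagger v = 1%:M by rewrite mulmx1.
  by rewrite [LHS]mx11_scalar v1.
have DE : U *m tau *m dagger U = rdiag (eigval tau).
  by rewrite {1}UE !mulmxA uU mul1mx -mulmxA uU mulmx1.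
have eE i : eigval tau i * eigval tau i = eigval tau i.

  have : (U *m tau *m dagger U) *m (U *m tau *m dagger U) = U *m tau *m dagger U.
    rewrite !mulmxA -(mulmxA (U *m tau) (dagger U) U) unitary_opC // mulmx1.
    by rewrite -(mulmxA U tau tau) tt.
  rewrite DE mul_rdiag => /matrixP/(_ i i); rewrite !rdiagE eqxx.
  by move=> /(@complexI R).
rewrite -(density_sum_eigval dt) retr_mxpowR; apply: eq_bigr => i _.
have [->|e0] := eqVneq (eigval tau i) 0; first by rewrite powR0 // gt_eqF.
by have /(mulfI e0) -> : eigval tau i * eigval tau i = eigval tau i * 1;
  rewrite ?mulr1 ?powR1.
Qed.

Lemma retr_mxpowR_unitary (R : realType) n (A U : 'M[R[i]]_n) (a : R) :
  dagger A = A -> is_unitary_op U ->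
  retr (mxpowR (U *m A *m dagger U) a) = retr (mxpowR A a).
Proof.
move=> hA uU; have D := diagonalizesJ uU (spectral_diagonalizes hA).
by rewrite (retr_mxpowR_diag _ D) retr_mxpowR.
Qed.

Lemma JabC (R : realType) n (rho sigma : 'M[R[i]]_n) (a b : R) :
  Jab a b rho sigma = Jab a b sigma rho.
Proof. by rewrite /Jab (addrC rho sigma); apply: addrAC. Qed.

(** * Lipschitz bounds in the trace norm *)

Lemma trnormZ (R : realType) n (A : 'M[R[i]]_n) (c : R) :
  dagger A = A -> trnorm ((c%:C)%C *: A) = `|c| * trnorm A.
Proof.
move=> hA; rewrite /trnorm mulrCA; congr (_ * _).
rewrite (retr_mxabs_diag (diagonalizesZ c (spectral_diagonalizes hA))).
by rewrite retr_mxabs mulr_sumr; apply: eq_bigr => i _; rewrite normrM.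
Qed.

Lemma trnormB (R : realType) n (A B : 'M[R[i]]_n) :
  dagger A = A -> dagger B = B -> trnorm (A - B) = trnorm (B - A).
Proof.
move=> hA hB; have h : dagger (B - A) = B - A by rewrite daggerD daggerN hA hB.
have := trnormZ (-1) h; rewrite normrN1 mul1r => <-.
by congr trnorm; rewrite rmorphN rmorph1 scaleN1r opprB.
Qed.

Lemma retr_mxpowR_sub_le (R : realType) n (rho sigma : 'M[R[i]]_n) (a : R) :
  1 <= a -> is_density rho -> is_density sigma ->
  retr (mxpowR rho a) - retr (mxpowR sigma a) <= a * trnorm (rho - sigma).
Proof.
move=> a1 dr ds; have [hr _ _] := dr; have [hs _ _] := ds.
have ps := density_psd ds.
have UD := spectral_diagonalizes hr; set U := spectralmx rho in UD.
have [uU _] := UD.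
have hd : dagger (rho - sigma) = rho - sigma by rewrite daggerD daggerN hr hs.
have H1 := peierls_psd (jensen_powR_ge1 a1) uU ps; rewrite -mxpowRE in H1.
have H2 : \sum_i `|diagent U (rho - sigma) i| <= retr (mxabs (rho - sigma)).
  rewrite retr_mxabs.
  apply: (peierls (f := fun x => `|x|)) (spectral_diagonalizes hd) => // p p0 _.
  apply: le_trans (ler_norm_sum _ _ _) _; apply: ler_sum => j _.
  by rewrite normrM (ger0_norm (p0 j)).
apply: le_trans (lerB (lexx _) H1) _; rewrite retr_mxpowR -sumrB.
apply: (@le_trans _ _ (\sum_i a * (2^-1 * (`|diagent U (rho - sigma) i|
    + diagent U (rho - sigma) i)))).
  apply: ler_sum => i _; rewrite diagentB (diagent_self _ UD).
  apply: powR_sub_le => //; first exact: density_eigval_le1.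
  exact: psd_diagent_ge0.
rewrite -!mulr_sumr big_split /= sum_diagent //.
(* The linear halves of the entrywise bounds sum to this trace, leaving only the absolute values. *)
have -> : retr (rho - sigma) = 0.
  by rewrite retrB !retr_density // subrr.
rewrite addr0 /trnorm !ler_wpM2l ?invr_ge0 //; lra.
Qed.

Lemma ler_distl_sym (R : realType) (x y t : R) :
  x - y <= t -> y - x <= t -> `|x - y| <= t.
Proof. by move=> h1 h2; rewrite ler_norml; apply/andP; split; lra. Qed.

(** Both traces lie in [[0, 1]], so [powR_sub_le] with exponent [b] costs one more factor [b].
    Symmetry of the trace norm reduces the claim to a one-sided bound. *)
Lemma powR_retr_mxpowR_lipschitz (R : realType) n (rho sigma : 'M[R[i]]_n)
    (a b : R) :
  1 <= a -> 1 <= b -> is_density rho -> is_density sigma ->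
  `|powR (retr (mxpowR rho a)) b - powR (retr (mxpowR sigma a)) b|
    <= a * b * trnorm (rho - sigma).
Proof.
move=> a1 b1.
suff H (A B : 'M[R[i]]_n) : is_density A -> is_density B ->
    powR (retr (mxpowR A a)) b - powR (retr (mxpowR B a)) b
    <= a * b * trnorm (A - B).
  move=> dr ds; apply: ler_distl_sym; first exact: H.
  have [hr _ _] := dr; have [hs _ _] := ds; rewrite (trnormB hr hs).
  exact: H.
move=> dA dB; have [hA _ _] := dA; have [hB _ _] := dB.
have H : `|retr (mxpowR A a) - retr (mxpowR B a)| <= a * trnorm (A - B).
  apply: ler_distl_sym; first exact: retr_mxpowR_sub_le.
  by rewrite (trnormB hA hB); apply: retr_mxpowR_sub_le.
have x1 : 0 <= retr (mxpowR A a) <= 1.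
  by rewrite retr_mxpowR_ge0 retr_mxpowR_le1.
apply: le_trans (powR_sub_le b1 x1 (retr_mxpowR_ge0 B a)) _.
rewrite (mulrC a) -mulrA ler_pM2l; last by lra.
have F (x y t : R) : `|x - y| <= t -> 2^-1 * (`|x - y| + (x - y)) <= t.
  by have := ler_norm (x - y); lra.
exact: F H.
Qed.

(** Two equal halves: the [M] terms through the halved distance of the midpoints, the [X] terms
    through their weight 1/2. They add up to [a b t], and dividing by [(a - 1) b] removes [b]. *)
Lemma powR_gap_lipschitz (R : realType) (a b t M1 M2 X1 X2 Y : R) :
  1 < a -> 1 <= b -> `|X1 - X2| <= a * b * t ->
  `|M1 - M2| <= a * b * (2^-1 * t) ->
  `|(M1 - 2^-1 * (X1 + Y)) / ((1 - a) * b)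
    - (M2 - 2^-1 * (X2 + Y)) / ((1 - a) * b)| <= a / (a - 1) * t.
Proof.
move=> a1 b1 h1 h2; have b0 : 0 < b by lra.
have a0 : 0 < a - 1 by lra.
have a0' : 1 - a != 0 by rewrite lt_eqF //; lra.
have D0 : 0 < ((a - 1) * b)^-1 by rewrite invr_gt0 mulr_gt0.
have -> : (M1 - 2^-1 * (X1 + Y)) / ((1 - a) * b)
    - (M2 - 2^-1 * (X2 + Y)) / ((1 - a) * b)
    = - (M1 - M2 - 2^-1 * (X1 - X2)) / ((a - 1) * b).
  by field; rewrite a0' !gt_eqF.
have -> : a / (a - 1) * t = a * b * t / ((a - 1) * b).
  by field; rewrite !gt_eqF.
rewrite normrM normrN (gtr0_norm D0) ler_pM2r //.
move: h1 h2; rewrite !ler_norml => /andP[? ?] /andP[? ?].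
by apply/andP; split; lra.
Qed.

Lemma Jab_lipschitz (R : realType) n (rho1 rho2 sigma : 'M[R[i]]_n) (a b : R) :
  1 < a -> 1 <= b ->
  is_density rho1 -> is_density rho2 -> is_density sigma ->
  `|Jab a b rho1 sigma - Jab a b rho2 sigma|
    <= a / (a - 1) * trnorm (rho1 - rho2).
Proof.
move=> a1 b1 d1 d2 ds; have [h1 _ _] := d1; have [h2 _ _] := d2.
have H := powR_retr_mxpowR_lipschitz (ltW a1) b1 d1 d2.
have := powR_retr_mxpowR_lipschitz (ltW a1) b1
  (density_mid d1 ds) (density_mid d2 ds).
have -> : (2%:R)^-1 *: (rho1 + sigma) - (2%:R)^-1 *: (rho2 + sigma)
        = ((2^-1)%:C)%C *: (rho1 - rho2).
  by rewrite -scalerBr complex_half opprD addrACA subrr addr0.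
rewrite trnormZ ?daggerD ?daggerN ?h1 ?h2 //.
rewrite (@ger0_norm R 2^-1) ?invr_ge0 // => Hm.
by rewrite !JabE; apply: powR_gap_lipschitz.
Qed.

Theorem theorem1 (R : realType) :
  (* (i) nonnegativity and upper bound *)
  (forall (a b : R),
      ((0 < a < 1) /\ (b < 0 \/ 0 < b < 1)) \/ (1 < a /\ 1 <= b) ->
      forall (n : nat) (rho sigma : 'M[R[i]]_n),
        is_density rho -> is_density sigma -> 0 <= Jab a b rho sigma) /\
  (forall (a b : R), 1 < a -> 1 <= b ->
      forall (n : nat) (rho sigma : 'M[R[i]]_n),
        is_density rho -> is_density sigma ->
        Jab a b rho sigma <= (powR 2 (1 - a * b) - 1) / ((1 - a) * b)) /\
  (* (ii) tensoring with a common state tau *)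
  (forall (a b : R), (0 < a < 1 \/ 1 < a) -> b != 0 ->
      forall (n k : nat) (rho sigma : 'M[R[i]]_n) (tau : 'M[R[i]]_k),
        is_density rho -> is_density sigma -> is_density tau ->
        Jab a b (rho *t tau) (sigma *t tau)
          = (1 + (1 - a) * b * Sab a b tau) * Jab a b rho sigma /\
        (is_pure tau -> Jab a b (rho *t tau) (sigma *t tau) = Jab a b rho sigma)) /\
  (* (iii) unitary invariance *)
  (forall (a b : R), (0 < a < 1 \/ 1 < a) -> b != 0 ->
      forall (n : nat) (rho sigma U : 'M[R[i]]_n),
        is_density rho -> is_density sigma -> is_unitary_op U ->
        Jab a b (U *m rho *m dagger U) (U *m sigma *m dagger U) = Jab a b rho sigma) /\
  (* (iv) symmetry *)
  (forall (a b : R), (0 < a < 1 \/ 1 < a) -> b != 0 ->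
      forall (n : nat) (rho sigma : 'M[R[i]]_n),
        is_density rho -> is_density sigma ->
        Jab a b rho sigma = Jab a b sigma rho) /\
  (* (v) continuity bounds in trace distance *)
  (forall (a b : R), 1 < a -> 1 <= b ->
      forall (n : nat) (rho rho1 rho2 sigma sigma1 sigma2 : 'M[R[i]]_n),
        is_density rho -> is_density rho1 -> is_density rho2 ->
        is_density sigma -> is_density sigma1 -> is_density sigma2 ->
        `|Jab a b rho1 sigma - Jab a b rho2 sigma| <= a / (a - 1) * trnorm (rho1 - rho2) /\
        `|Jab a b rho sigma1 - Jab a b rho sigma2| <= a / (a - 1) * trnorm (sigma1 - sigma2)).
Proof.
split; first exact: Jab_ge0.
split; first exact: Jab_le.
split.
  move=> a b ha b0 n k rho sigma tau dr ds dt.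
  have a0 : 0 < a by case: ha => [/andP[]|]; lra.
  have a1 : 1 - a != 0.
    by rewrite subr_eq0; case: ha => [/andP[_ /gt_eqF->]|/lt_eqF->].
  rewrite Jab_tens //; split.
    (* Since [(1 - a) * b] is nonzero, the bracket is exactly [(Tr tau^a)^b]. *)
    by rewrite /Sab [_ * (_ / _)]mulrC divfK ?mulf_neq0 // addrC subrK.
  by move=> pt; rewrite retr_mxpowR_pure // powR1 mul1r.
split.
  move=> a b _ _ n rho sigma U dr ds uU.
  have [hr _ _] := dr; have [hs _ _] := ds.
  have [hm _ _] := density_mid dr ds.
  (* The midpoint of the conjugated states is brought to the form of a conjugated midpoint. *)
  rewrite !JabE -mulmxDl -mulmxDr scalemxAl scalemxAr.
  have F (M X Y m x y d : R) : M = m -> X = x -> Y = y ->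
      (powR M b - 2^-1 * (powR X b + powR Y b)) * d
      = (powR m b - 2^-1 * (powR x b + powR y b)) * d by move=> -> -> ->.
  exact: F (retr_mxpowR_unitary a hm uU) (retr_mxpowR_unitary a hr uU)
    (retr_mxpowR_unitary a hs uU).
split; first by move=> a b _ _ n rho sigma _ _; apply: JabC.
move=> a b a1 b1 n rho rho1 rho2 sigma sigma1 sigma2 d d1 d2 s s1 s2; split.
  exact: Jab_lipschitz.
(* Symmetry moves the varying state into the first argument. *)
by rewrite (JabC rho sigma1) (JabC rho sigma2); apply: Jab_lipschitz.
Qed.
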